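(* For every $n\ge 0$, there is a bijection between the set $\mathcal{A}_{2n}$ of alternating faro permutations of length $2n$ and the set of Dyck paths of length $2n$.
   Context: A faro permutation of length $m$ is a permutation $w=w_1\cdots w_m$ of $\{1,\dots,m\}$ obtained by interlacing two increasing words $u,v$ as $u_1v_1u_2v_2\cdots$ with $0\le|u|-|v|\le1$ (equivalently, $w_i<w_{i+2}$ for all $1\le i\le m-2$). It is alternating if $w_1>w_2<w_3>w_4<\cdots$. A Dyck path of length $2n$ is a lattice path from $(0,0)$ to $(2n,0)$ with steps $U=(1,1)$ and $D=(1,-1)$ never going below the $x$-axis. *)

(* Defs.v *)
From mathcomp Require Import all_boot all_order all_algebra all_fingroup.
From mathcomp Require Import classical_sets functions.

Set Implicit Arguments.
Unset Strict Implicit.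
Unset Printing Implicit Defensive.

Import Order.TTheory GRing.Theory Num.Theory.

Local Open Scope nat_scope.

(* The word w_1 ... w_m on the letters 1, ..., m: 'S_m acts on 0, ..., m - 1,
   hence the successor. *)
Definition one_line m (w : 'S_m) : seq nat :=
  [seq (w i).+1 | i <- enum 'I_m].

(* u_1 v_1 u_2 v_2 ...; if one word runs out, the rest of the other is
   appended. *)
Fixpoint interlace (T : Type) (u v : seq T) : seq T :=
  match u, v with
  | x :: u', y :: v' => x :: y :: interlace u' v'
  | _, _ => u ++ v
  end.

Definition faro m (w : 'S_m) : Prop :=
  exists u v : seq nat,
    [/\ sorted ltn u, sorted ltn v,
        size v <= size u <= (size v).+1 &
        one_line w = interlace u v].

(* nth counts from 0, so the descents w_1 > w_2, w_3 > w_4, ... sit at even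
   indices. *)
Definition alternating (s : seq nat) : Prop :=
  forall i, i.+1 < size s ->
    if odd i then nth 0 s i < nth 0 s i.+1 else nth 0 s i > nth 0 s i.+1.

Definition alternating_faro m : set 'S_m :=
  [set w | faro w /\ alternating (one_line w)]%classic.

Inductive step : Type := Up | Down.

Definition step_vec (s : step) : int * int :=
  match s with Up => (1, 1)%R | Down => (1, -1)%R end.

Definition endpoint (p : seq step) : int * int :=
  (\sum_(s <- p) step_vec s)%R.

(* The vertices of the path are the endpoints of its prefixes; staying weakly
   above the axis at the vertices is the same as staying so throughout. *)
Definition dyck_paths (m : nat) : set (seq step) :=
  [set p | endpoint p = (m%:Z, 0)%R /\
           forall k, (0 <= (endpoint (take k p)).2)%R]%classic.

(* Main.v *)
Require Import Defs.
From mathcomp Require Import all_boot all_order all_algebra all_fingroup.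
From mathcomp Require Import classical_sets functions.
From mathcomp Require Import zify.

(** Split an alternating faro permutation [w] of length [2n] into the increasing
words [u] (odd places) and [v] (even places).  Being alternating then amounts to
[v_i < u_i] for all [i]: the remaining inequalities [v_i < u_{i+1}] follow from
[v_i < u_i < u_{i+1}].  So [w] is the same thing as a standard Young tableau
with two rows of length [n], and the classical bijection applies: step number
[k] of the path is up when the letter [k] lies in [v], and down when it lies in
[u].

After [k] steps the height of the path is the number of letters at most [k] in
[v] minus the number of those in [u] ([endpoint_take_up_path]).  For two
increasing words of the same length, the counts in [v] dominate the counts in
[u] for every threshold [k] exactly when [v] lies entrywise below [u]
([all_leq_count]).  This identifies the tableau condition with the Dyck
condition, in both directions.  The path determines the set of letters of [v],
hence the increasing words [v] and [u], hence [w]; conversely, the positions of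
the steps of any Dyck path fill a tableau ([dyck_tableau]), whose interlaced
rows form a permutation ([word_perm]). *)

Set Implicit Arguments.
Unset Strict Implicit.
Unset Printing Implicit Defensive.

Import GRing.Theory Num.Theory.

Local Open Scope nat_scope.

(** * Interlacing two words of equal length *)

Lemma perm_interlace (u v : seq nat) : perm_eq (interlace u v) (u ++ v).
Proof.
elim: u v => [|x u IH] [|y v] //=.
rewrite perm_cons perm_sym perm_catC cat_cons perm_cons perm_catC perm_sym.
exact: IH.
Qed.

Lemma nth_interlace (u v : seq nat) (i : nat) : size u = size v ->
  nth 0 (interlace u v) i = nth 0 (if odd i then v else u) i./2.
Proof.
elim: u v i => [|x u IH] [|y v] //= i; first by rewrite if_same !nth_nil.
case: i => [|[|i]] //= [eq_uv]; rewrite negbK IH //.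
by case: (odd i).
Qed.

(** This recovers the second word from an interlacing, which lets the path be
defined on every permutation, without choosing the two words. *)
Fixpoint even_places (s : seq nat) : seq nat :=
  if s is _ :: y :: s' then y :: even_places s' else [::].

Lemma even_places_interlace (u v : seq nat) :
  size u = size v -> even_places (interlace u v) = v.
Proof. by elim: u v => [|x u IH] [|y v] //= [/IH ->]. Qed.

(** * Two-row tableaux and alternating faro permutations *)

(** A standard Young tableau of rectangular shape: [v] is its first row and [u]
its second.  The second row comes first here because a word starts with [u]. *)
Definition tableau (N : nat) (u v : seq nat) : Prop :=
  [/\ sorted ltn u, sorted ltn v, size u = size v, perm_eq (u ++ v) (iota 1 N) &
      forall i, i < size u -> nth 0 v i < nth 0 u i].

Lemma size_rows (N : nat) (u v : seq nat) :
  perm_eq (u ++ v) (iota 1 N) -> size u + size v = N.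
Proof. by move/perm_size; rewrite size_cat size_iota. Qed.

Lemma perm_one_line m (w : 'S_m) : perm_eq (one_line w) (iota 1 m).
Proof.
have uniq_w : uniq (one_line w).
  by rewrite map_inj_uniq ?enum_uniq // => i j [/val_inj/perm_inj].
have sub_w : {subset one_line w <= iota 1 m}.
  by move=> _ /mapP[i _ ->]; rewrite mem_iota /= ltnS ltn_ord.
have [|_ mem_w] := uniq_min_size uniq_w sub_w.
  by rewrite size_iota size_map size_enum_ord.
exact: uniq_perm uniq_w (iota_uniq _ _) mem_w.
Qed.

Lemma one_line_inj m : injective (@one_line m).
Proof.
move=> w w' eq_ww'; apply/permP => i; apply/val_inj.
have/eq_in_map/(_ i) : one_line w = one_line w' by [].
by rewrite mem_enum => /(_ isT) [].
Qed.

(** The letters of a word start at 1 and the values of a permutation at 0, hence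
the predecessors in the construction. *)
Lemma word_perm m (s : seq nat) :
  perm_eq s (iota 1 m) -> exists w : 'S_m, one_line w = s.
Proof.
move=> perm_s; have size_s : size s = m by rewrite (perm_size perm_s) size_iota.
have uniq_s : uniq s by rewrite (perm_uniq perm_s) iota_uniq.
have s_bnd (i : 'I_m) : 0 < nth 0 s i <= m.
  have : nth 0 s i \in iota 1 m by rewrite -(perm_mem perm_s) mem_nth // size_s.
  by rewrite mem_iota.
have pred_lt (i : 'I_m) : (nth 0 s i).-1 < m by have := s_bnd i; lia.
pose g i := Ordinal (pred_lt i).
have g_inj : injective g.
  move=> i j [eq_ij]; apply/val_inj/eqP.
  rewrite -(nth_uniq 0 _ _ uniq_s) ?size_s ?ltn_ord //; apply/eqP.
  have [/andP[i_pos _] /andP[j_pos _]] := (s_bnd i, s_bnd j).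
  by rewrite -(prednK i_pos) eq_ij prednK.
exists (perm g_inj); apply: (@eq_from_nth _ 0).
  by rewrite size_map size_enum_ord size_s.
rewrite size_map size_enum_ord => i lt_im.
rewrite (nth_map (Ordinal lt_im)) ?size_enum_ord // permE /=.
have -> : nth (Ordinal lt_im) (enum 'I_m) i = Ordinal lt_im.
  by apply: val_inj; rewrite /= nth_enum_ord.
by have /andP[/prednK] := s_bnd (Ordinal lt_im).
Qed.

(** The descents at odd places are the column inequalities of the tableau, and the
ascents follow from these: [v_i < u_i < u_{i+1}]. *)
Lemma alternating_faroP n (w : 'S_(2 * n)) :
  alternating_faro w <->
  exists u v, tableau (2 * n) u v /\ one_line w = interlace u v.
Proof.
have perm_w := perm_one_line w.
split=> [[[u [v [sort_u sort_v size_uv w_uv]]] alt_w] |].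
  have perm_uv : perm_eq (u ++ v) (iota 1 (2 * n)).
    by rewrite -(permPl (perm_interlace u v)) -w_uv.
  have size_2n := size_rows perm_uv.
  (* The total length is even, so the first word is not longer by one. *)
  have eq_uv : size u = size v by lia.
  exists u, v; split=> //; split=> // i lt_iu.
  have := alt_w i.*2; rewrite (perm_size perm_w) size_iota odd_double.
  rewrite w_uv !nth_interlace //= odd_double /= uphalf_double doubleK.
  by apply; lia.
move=> [u [v [[sort_u sort_v eq_uv perm_uv lt_vu] w_uv]]].
split; first by exists u, v; split=> //; rewrite eq_uv leqnn leqnSn.
have size_2n := size_rows perm_uv.
move=> i; rewrite (perm_size perm_w) size_iota w_uv !nth_interlace //= => lt_i.
case: ifPn => [odd_i | even_i].
  rewrite /= uphalf_half odd_i /= add1n.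
  have lt_i2 : (i./2).+1 < size u by lia.
  apply: (ltn_trans (lt_vu _ (ltnW lt_i2))).
  exact: (sorted_ltn_nth ltn_trans 0 sort_u) (ltnW lt_i2) lt_i2 (ltnSn _).
by rewrite /= uphalf_half (negbTE even_i); apply: lt_vu; lia.
Qed.

(** * Entrywise comparison by counting *)

(** In an increasing word the letters at most [k] form a prefix, whose length is
their number. *)
Lemma sorted_nth_leq_count (s : seq nat) (i k : nat) : sorted ltn s ->
  i < size s -> (nth 0 s i <= k) = (i < count (leq^~ k) s).
Proof.
elim: s i => // x s IH i path_xs lt_is.
have all_x : all (ltn x) s := order_path_min ltn_trans path_xs.
case: (leqP x k) => [le_xk | lt_kx].
  case: i lt_is => [|i] lt_is /=; first by rewrite le_xk.
  by rewrite le_xk add1n ltnS IH // (path_sorted path_xs).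
have all_k : all (ltn k) (x :: s).
  by rewrite /= lt_kx; apply: sub_all all_x => y; apply: ltn_trans.
have/eqP -> : count (leq^~ k) (x :: s) == 0.
  rewrite eqn0Ngt -has_count -all_predC; apply: sub_all all_k => y /=.
  by rewrite -ltnNge.
by apply/negbTE; rewrite -ltnNge; apply: (allP all_k); apply: mem_nth.
Qed.

(** By [sorted_nth_leq_count] both sides say that [u_i <= k] implies [v_i <= k],
for all [i] and [k]. *)
Lemma all_leq_count (u v : seq nat) : sorted ltn u -> sorted ltn v ->
  size u = size v ->
  (forall i, i < size u -> nth 0 v i <= nth 0 u i) <->
  (forall k, count (leq^~ k) u <= count (leq^~ k) v).
Proof.
move=> sort_u sort_v eq_uv; split=> [le_vu k | le_count i lt_iu].
  case def_c: (count _ u) => [//|c].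
  have lt_cu : c < size u by rewrite -ltnS -def_c ltnS count_size.
  rewrite -sorted_nth_leq_count -?eq_uv //; apply: leq_trans (le_vu _ lt_cu) _.
  by rewrite sorted_nth_leq_count // def_c.
rewrite sorted_nth_leq_count -?eq_uv //; apply: leq_trans (le_count _).
by rewrite -sorted_nth_leq_count.
Qed.

(** * The path of a tableau *)

Definition up_path (N : nat) (v : seq nat) : seq step :=
  [seq if k \in v then Up else Down | k <- iota 1 N].

Lemma endpoint_up_path (N : nat) (v : seq nat) :
  endpoint (up_path N v) =
  (N%:Z, (count [in v] (iota 1 N))%:Z
         - (count (predC [in v]) (iota 1 N))%:Z)%R.
Proof.
rewrite /endpoint big_map -{2}(size_iota 1 N).
elim: (iota 1 N) => [|k s IH]; first by rewrite big_nil subrr.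
rewrite big_cons IH /=; case: (k \in v); congr pair => /=; lia.
Qed.

Lemma count_mem_iota (s : seq nat) (k : nat) : uniq s -> 0 \notin s ->
  count [in s] (iota 1 k) = count (leq^~ k) s.
Proof.
move=> uniq_s s_pos; rewrite -!size_filter; apply/perm_size/uniq_perm.
- by rewrite filter_uniq ?iota_uniq.
- by rewrite filter_uniq.
move=> x; rewrite !mem_filter mem_iota add1n ltnS andbC /=.
by case: x => [|x] /=; rewrite ?(negbTE s_pos) ?andbF.
Qed.

(** The first [min k N] steps are labelled by the letters at most [k]: each of
them goes up if its label is in [v], and down if it is in [u].  The heights
therefore compare the numbers of letters at most [k] in the two rows, which is
the form that [all_leq_count] turns into an entrywise comparison. *)
Lemma endpoint_take_up_path (N : nat) (u v : seq nat) (k : nat) :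
  perm_eq (u ++ v) (iota 1 N) ->
  endpoint (take k (up_path N v)) =
  ((minn k N)%:Z, (count (leq^~ k) v)%:Z - (count (leq^~ k) u)%:Z)%R.
Proof.
move=> perm_uv; rewrite -map_take take_iota -/(up_path _ v) endpoint_up_path.
have := perm_uniq perm_uv; rewrite iota_uniq cat_uniq => /and3P[uniq_u dis uniq_v].
have mem_uv := perm_mem perm_uv.
have : 0 \notin u ++ v by rewrite mem_uv mem_iota.
rewrite mem_cat negb_or => /andP[u_pos v_pos].
have in_uv x : x \in iota 1 (minn k N) -> predC [in v] x = (x \in u).
  move=> x_in; have /= : x \in u ++ v.
    by move: x_in; rewrite mem_uv !mem_iota; lia.
  rewrite mem_cat; case xv: (x \in v) => /=; last by rewrite orbF.
  by move=> _; apply/esym/negbTE/(hasPn dis).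
have count_min s : {subset s <= u ++ v} ->
    count (leq^~ (minn k N)) s = count (leq^~ k) s.
  move=> sub_s; apply: eq_in_count => x /sub_s.
  by rewrite mem_uv mem_iota; lia.
rewrite (eq_in_count in_uv) !count_mem_iota // !count_min // => x x_in.
  by rewrite mem_cat x_in.
by rewrite mem_cat x_in orbT.
Qed.

Lemma endpoint_up_path_rows (N : nat) (u v : seq nat) :
  perm_eq (u ++ v) (iota 1 N) ->
  endpoint (up_path N v) = (N%:Z, (size v)%:Z - (size u)%:Z)%R.
Proof.
move=> perm_uv; have take_N : take N (up_path N v) = up_path N v.
  by rewrite take_oversize // size_map size_iota.
rewrite -take_N (endpoint_take_up_path N perm_uv) minnn.
have count_all s : {subset s <= u ++ v} -> count (leq^~ N) s = size s.
  move=> sub_s; apply/eqP; rewrite -all_count; apply/allP => x /sub_s.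
  by rewrite (perm_mem perm_uv) mem_iota; lia.
rewrite !count_all // => x x_in; first by rewrite mem_cat x_in.
by rewrite mem_cat x_in orbT.
Qed.

Lemma up_path_dyck (N : nat) (u v : seq nat) :
  tableau N u v -> dyck_paths N (up_path N v).
Proof.
move=> [sort_u sort_v eq_uv perm_uv lt_vu]; split; last first.
  move=> k; rewrite (endpoint_take_up_path k perm_uv) /= subr_ge0 lez_nat.
  by apply: (all_leq_count sort_u sort_v eq_uv).1 => i /lt_vu/ltnW.
by rewrite (endpoint_up_path_rows perm_uv) eq_uv subrr.
Qed.

(** The up steps give the set of letters of [v], and [u] holds the remaining
letters; an increasing word is determined by its set of letters. *)
Lemma up_path_inj (N : nat) (u v u' v' : seq nat) :
  tableau N u v -> tableau N u' v' -> up_path N v = up_path N v' ->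
  u = u' /\ v = v'.
Proof.
move=> [su sv _ p _] [su' sv' _ p' _] /eq_in_map eq_path.
have mem_v : v =i v'.
  move=> x; case x_in: (x \in iota 1 N).
    by have := eq_path x x_in; do 2!case: (x \in _).
  move: (x_in); rewrite -(perm_mem p) mem_cat => /norP[_ /negbTE ->].
  by move: x_in; rewrite -(perm_mem p') mem_cat => /norP[_ /negbTE ->].
have eq_v : v = v' := irr_sorted_eq ltn_trans ltnn sv sv' mem_v.
split=> //; apply: (irr_sorted_eq ltn_trans ltnn su su').
apply: perm_mem; rewrite -(perm_cat2r v) {2}eq_v.
by rewrite (permPl p) perm_sym.
Qed.

(** * The tableau of a Dyck path *)

Definition is_up (s : step) : bool := if s is Up then true else false.

Lemma size_dyck (N : nat) (p : seq step) : dyck_paths N p -> size p = N.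
Proof.
move=> [end_p _]; have : (endpoint p).1 = N%:Z%R by rewrite end_p.
have -> : (endpoint p).1 = (size p)%:Z%R; last by case.
rewrite /endpoint; elim: p {end_p} => [|s p IH]; first by rewrite big_nil.
by rewrite big_cons /= IH; case: s => /=; lia.
Qed.

(** Take for [v] the positions of the up steps and for [u] those of the down
steps.  Ending on the axis makes the rows equally long, and staying weakly above
it gives the column inequalities by [all_leq_count]. *)
Lemma dyck_tableau (N : nat) (p : seq step) : dyck_paths N p ->
  exists u v, tableau N u v /\ up_path N v = p.
Proof.
move=> dyck_p; have size_p := size_dyck dyck_p.
pose up k := is_up (nth Down p k.-1).
pose u := filter (predC up) (iota 1 N); pose v := filter up (iota 1 N).
have perm_uv : perm_eq (u ++ v) (iota 1 N).
  by rewrite perm_catC perm_filterC.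
have path_v : up_path N v = p.
  rewrite -[RHS](mkseq_nth Down) /mkseq size_p /up_path (iotaDl 1 0) -map_comp.
  apply/eq_in_map => k; rewrite mem_iota /= => lt_kN.
  rewrite mem_filter mem_iota /up /=.
  by rewrite !add1n ltnS lt_kN andbT; case: (nth _ p k).
have sort_u : sorted ltn u.
  exact: sorted_filter ltn_trans _ _ (iota_ltn_sorted _ _).
have sort_v : sorted ltn v.
  exact: sorted_filter ltn_trans _ _ (iota_ltn_sorted _ _).
exists u, v; split=> //; case: dyck_p => end_p pos_p.
have le_count k : count (leq^~ k) u <= count (leq^~ k) v.
  have := pos_p k; rewrite -path_v (endpoint_take_up_path k perm_uv) /=.
  by rewrite subr_ge0 lez_nat.
have eq_uv : size u = size v.
  by move: end_p; rewrite -path_v (endpoint_up_path_rows perm_uv) => - []; lia.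
split=> // i lt_iu; rewrite ltn_neqAle; apply/andP; split; last first.
  exact: (all_leq_count sort_u sort_v eq_uv).2.
(* The rows are disjoint, so the weak comparison is strict. *)
have := perm_uniq perm_uv; rewrite iota_uniq cat_uniq => /and3P[_ /hasPn dis _].
apply/eqP => eq_i; have /dis/negP[] : nth 0 v i \in v by rewrite mem_nth -?eq_uv.
by rewrite /= eq_i mem_nth.
Qed.

(** * The bijection *)

Theorem theorem4p4 (n : nat) :
  exists f : 'S_(2 * n) -> seq step,
    set_bij (@alternating_faro (2 * n)) (dyck_paths (2 * n)) f.
Proof.
exists (fun w => up_path (2 * n) (even_places (one_line w))); split.
- move=> w /alternating_faroP[u [v [tab ->]]] /=.
  have [_ _ eq_uv _ _] := tab; rewrite even_places_interlace //.
  exact: up_path_dyck tab.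
- move=> w w' /set_mem/alternating_faroP[u [v [tab w_uv]]].
  move=> /set_mem/alternating_faroP[u' [v' [tab' w_uv']]].
  have [_ _ eq_uv _ _] := tab; have [_ _ eq_uv' _ _] := tab'.
  rewrite w_uv w_uv' !even_places_interlace // => /(up_path_inj tab tab') [eq_u eq_v].
  by apply: one_line_inj; rewrite w_uv w_uv' eq_u eq_v.
move=> p /dyck_tableau[u [v [tab path_v]]].
have [_ _ eq_uv perm_uv _] := tab.
have [w w_uv] : exists w : 'S_(2 * n), one_line w = interlace u v.
  by apply: word_perm; rewrite (permPl (perm_interlace u v)).
exists w; first by apply/alternating_faroP; exists u, v.
by rewrite w_uv even_places_interlace.
Qed.
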